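(* There is an absolute constant $c>0$ such that the following holds. Let $H$ be a bipartite graph on $h$ vertices. Then there exists $n_0=n_0(H)$ such that for every $n\geq n_0$, every graph $G$ on $n$ vertices which contains no induced copy of $H$ contains either an independent set of size at least $n^{c/h}$ or a (not necessarily induced) complete bipartite subgraph $K_{m,m}$ with $m\geq n^{c/h}$. *)

(* Defs.v *)
From mathcomp Require Import all_boot.
From Stdlib Require Import Reals.
Set Implicit Arguments. Unset Strict Implicit. Unset Printing Implicit Defensive.

Definition simple_graph (T : finType) (e : rel T) : Prop :=
  (forall x y, e x y = e y x) /\ (forall x, e x x = false).

Definition bipartite (T : finType) (e : rel T) : Prop :=
  exists col : T -> bool, forall x y, e x y -> col x <> col y.

Definition has_induced_copy (TH TG : finType) (eH : rel TH) (eG : rel TG) : Prop :=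
  exists f : TH -> TG, injective f /\ forall x y, eG (f x) (f y) = eH x y.

Definition independent (T : finType) (e : rel T) (S : {set T}) : Prop :=
  forall x y, x \in S -> y \in S -> e x y = false.

Definition has_Kmm (T : finType) (e : rel T) (m : nat) : Prop :=
  exists A B : {set T}, #|A| = m /\ #|B| = m /\ [disjoint A & B] /\
    (forall a b, a \in A -> b \in B -> e a b).

(* Main.v *)
(** Let m be about n^(1/(20h)), and assume that G has no K_{m,m} and that all its independent
sets have fewer than m vertices.  The second assumption gives at least n/2 vertices of degree at
least n/(4m), so dependent random choice yields a large set U in which every h vertices have many
common neighbours.  Since K_{m,m} is absent, fewer than m vertices are adjacent to almost all of a
given large set W.  This has two consequences.  First, the number N_s of independent s-tuples of
distinct vertices of U satisfies N_s^2 <= 16 m N_(s-1) N_(s+1) roughly, so N_h exceeds N_(h-1) by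
a factor |U|/(16m)^h, which is much larger than h^2 m.  Second, for prescribed adjacencies b in H,
the common neighbourhood of the a_i with i ~ b keeps a fraction 1/(4m) of its vertices each time it
is restricted to the non-neighbours of one further a_k, unless a_k lies in a set of fewer than m
vertices determined by the other coordinates; this spoils at most h^2 m N_(h-1) tuples.  Hence some
independent tuple a realises all adjacency patterns of H on large sets W_b, and an independent
transversal of the W_b is found greedily.  The tuples are indexed by all vertices of H; the
copy of H uses a on one colour class and the transversal on the other. *)

Require Import Defs.
From mathcomp Require Import all_boot zify.
Set Implicit Arguments. Unset Strict Implicit. Unset Printing Implicit Defensive.

(** * Non-adjacency in graphs without K_{m,m} *)

(** Distinctness is built in, so that pairwise [nonadj] vertices never coincide and can serve as
    images of distinct vertices of H. *)
Definition nonadj (V : finType) (e : rel V) : rel V :=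
  fun x y => (x != y) && ~~ e x y.

Lemma nonadj_sym (V : finType) (e : rel V) :
  simple_graph e -> symmetric (nonadj e).
Proof. by case=> esym _ x y; rewrite /nonadj eq_sym esym. Qed.

Lemma subset_of_card (V : finType) (A : {set V}) (m : nat) :
  m <= #|A| -> exists2 B : {set V}, B \subset A & #|B| = m.
Proof.
case/card_geqP=> s [us <- sA]; exists [set:: s].
  by apply/subsetP=> x; rewrite inE => /sA.
by rewrite cardsE; apply/card_uniqP.
Qed.

Lemma card_bigcup_le (I V : finType) (X : {set I}) (F : I -> {set V}) :
  #|\bigcup_(x in X) F x| <= \sum_(x in X) #|F x|.
Proof.
elim/big_rec2: _ => [|x k A _ le]; first by rewrite cards0.
by rewrite (leq_trans (leq_card_setU _ _)) // leq_add2l.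
Qed.

(** Otherwise take [m] such vertices. Together with their non-neighbours they cover at most |W|/4 +
    m vertices of [W], so at least 2m vertices of [W] are adjacent to all of them, which yields
    K_{m,m}. *)
Lemma few_nearly_complete (V : finType) (e : rel V) (m : nat) (W : {set V}) :
  simple_graph e -> ~ has_Kmm e m -> 4 * m <= #|W| ->
  #|[set x | 4 * m * #|[set w in W | nonadj e x w]| < #|W|]| < m.
Proof.
move=> [esym eirr] nK leW; rewrite ltnNge; apply/negP=> /subset_of_card[X XS cX].
apply: nK.
pose C := [set w in W | [forall x in X, e x w]].
suff : m <= #|C|.
  case/subset_of_card=> B BC cB; exists X, B; split=> //; split=> //.
  have adj a b : a \in X -> b \in B -> e a b.
    by move=> aX /(subsetP BC); rewrite inE => /andP[_ /forall_inP]; apply.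
  split=> //; apply/pred0P=> x /=; apply/negP=> /andP[xX xB].
  by have := adj x x xX xB; rewrite eirr.
(* The vertex [x] is added because it is not its own neighbour, yet [nonadj e x x] is false. *)
have WC : W :\: C \subset \bigcup_(x in X) (x |: [set w in W | nonadj e x w]).
  apply/subsetP=> w; rewrite !inE => /andP[+ wW]; rewrite wW /= => /forall_inPn[x xX nexw].
  apply/bigcupP; exists x => //; rewrite !inE wW /nonadj nexw andbT /= eq_sym.
  by case: (x == w).
have : 4 * #|W :\: C| <= #|W| + 4 * m.
  apply: leq_trans (_ : 4 * (\sum_(x in X) (1 + #|[set w in W | nonadj e x w]|)) <= _).
    rewrite leq_mul2l; apply/orP; right.
    apply: leq_trans (subset_leq_card WC) _.
    apply: leq_trans (_ : \sum_(x in X) #|x |: [set w in W | nonadj e x w]| <= _).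
      exact: card_bigcup_le.
    by apply: leq_sum => x _; rewrite cardsU1; case: (_ \notin _); rewrite ?leqnSn.
  rewrite big_split /= sum1_card cX mulnDr addnC leq_add2r.
  case: (posnP m) => [m0|m0].
    by rewrite big_pred0 // => x; rewrite (cards0_eq (A := X)) ?inE // cX.
  rewrite -(leq_pmul2l m0) mulnA (mulnC m 4) big_distrr /=.
  rewrite -[in leqRHS]cX -sum_nat_const; apply: leq_sum => x xX.
  by have := subsetP XS x xX; rewrite inE => /ltnW.
have := cardsID C W; have -> : W :&: C = C by apply/setIidPr/subsetP=> x; rewrite inE => /andP[].
lia.
Qed.

(** * Many vertices of high degree *)

(** A maximal independent subset of [L] dominates [L]: the closed neighbourhoods of its vertices
    cover [L]. *)
Lemma large_independent (V : finType) (e : rel V) (L : {set V}) :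
  simple_graph e ->
  exists2 S : {set V}, independent e S &
    S \subset L /\ #|L| <= \sum_(x in S) #|[set y | e x y]|.+1.
Proof.
move=> [esym eirr].
pose P (S : {set V}) := (S \subset L) && [forall x in S, forall y in S, ~~ e x y].
have P0 : P set0.
  by rewrite /P sub0set; apply/forall_inP=> x; rewrite inE.
have [S /maxsetP[/andP[SL /forall_inP indS] maxS] _] := maxset_exists P0.
exists S; first by move=> x y xS yS; apply/negbTE; move/forall_inP: (indS x xS); apply.
split=> //.
have LS : L \subset \bigcup_(x in S) (x |: [set y | e x y]).
  apply/subsetP=> y yL; case yS : (y \in S).
    by apply/bigcupP; exists y; rewrite ?setU11.
  apply/bigcupP; case: (pickP [pred x in S | e x y]) => [x /andP[xS exy]|no].
    by exists x => //; rewrite !inE exy orbT.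
  have nadj x : x \in S -> ~~ e x y by move=> xS; have := no x; rewrite /= xS /= => ->.
  have PyS : P (y |: S).
    apply/andP; split; first by rewrite subUset sub1set yL.
    apply/forall_inP=> a; rewrite !inE => aS; apply/forall_inP=> b; rewrite !inE => bS.
    case/orP: aS => [/eqP->|aS]; case/orP: bS => [/eqP->|bS].
    - by rewrite eirr.
    - by rewrite esym nadj.
    - by rewrite nadj.
    - by move/forall_inP: (indS a aS); apply.
  by have := maxS _ PyS (subsetUr _ _); move/setP/(_ y); rewrite !inE eqxx yS.
apply: leq_trans (subset_leq_card LS) _.
apply: leq_trans (_ : \sum_(x in S) #|x |: [set y | e x y]| <= _).
  exact: card_bigcup_le.
by apply: leq_sum => x _; rewrite cardsU1; case: (_ \notin _).
Qed.

(** An independent set dominating the low-degree vertices has fewer than [m] elements, each with a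
    closed neighbourhood below 1 + n/(4m). Hence there are fewer than m + n/4 < n/2 low-degree
    vertices. *)
Lemma high_degree (V : finType) (e : rel V) (m : nat) :
  simple_graph e -> 0 < m ->
  (forall S : {set V}, independent e S -> #|S| < m) -> 4 * m < #|V| ->
  #|V| <= 2 * #|[set x | #|V| <= 4 * m * #|[set y | e x y]|]|.
Proof.
move=> sg m0 indm ltV; set X := [set x | _].
rewrite leqNgt; apply/negP=> ltX.
have [S indS [SX leX]] := large_independent (~: X) sg.
have le1 : 4 * m * #|~: X| <= #|S| * (4 * m + #|V|).
  apply: leq_trans (leq_mul (leqnn _) leX) _.
  rewrite big_distrr /= -sum_nat_const; apply: leq_sum => x /(subsetP SX).
  by rewrite !inE -ltnNge mulnS leq_add2l => /ltnW.
have := indm S indS; have := cardsC X; nia.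
Qed.

(** * Dependent random choice *)

Lemma sum_nat_bool_card (T : finType) (P : pred T) : \sum_x (P x : nat) = #|P|.
Proof. by rewrite -sum1_card [RHS]big_mkcond. Qed.

Definition common_nbrs (V : finType) (e : rel V) (s : nat) (z : {ffun 'I_s -> V}) :=
  [set w | [forall i, e (z i) w]].

Lemma card_tuples_in (V : finType) (t : nat) (A : {set V}) :
  #|[set T : {ffun 'I_t -> V} | [forall i, T i \in A]]| = #|A| ^ t.
Proof.
rewrite -[in RHS](card_ord t) -card_ffun_on cardsE; apply: eq_card => T.
by apply/forallP/ffun_onP.
Qed.

(** Averaging over all [t]-tuples [T], with the common neighbourhood of [T] as candidate for [U].
    The numerical hypothesis says that tuples spoiled by some [z], together with candidates smaller
    than [M], cannot account for the total size of the candidates. *)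
Lemma dependent_random_choice (V : finType) (e : rel V) (q s t K M : nat) :
  simple_graph e ->
  #|V| <= 2 * #|[set x | #|V| <= q * #|[set y | e x y]|]| ->
  2 * q ^ t * (#|V| ^ s * K ^ t * #|V| + #|V| ^ t * M) < #|V| ^ t * #|V| ->
  exists U : {set V}, M <= #|U| /\
    forall z : {ffun 'I_s -> V}, (forall i, z i \in U) -> K <= #|common_nbrs e z|.
Proof.
move=> [esym _]; set X := [set x | _]; set n := #|V| => leX ltn.
pose bad (T : {ffun 'I_t -> V}) :=
  [exists z : {ffun 'I_s -> V},
     [forall i, z i \in common_nbrs e T] && (#|common_nbrs e z| < K)].
(* A tuple [z] lies in the common neighbourhood of [T] exactly when [T] lies in that of [z], so each
   [z] with fewer than [K] common neighbours spoils at most K^t choices of [T]. *)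
have cbad : #|[set T | bad T]| <= n ^ s * K ^ t.
  have sub : [set T | bad T] \subset \bigcup_(z in [set z : {ffun 'I_s -> V} | #|common_nbrs e z| < K])
      [set T : {ffun 'I_t -> V} | [forall i, T i \in common_nbrs e z]].
    apply/subsetP=> T; rewrite inE => /existsP[z /andP[/forallP zT ltK]].
    apply/bigcupP; exists z; rewrite inE //; apply/forallP=> j.
    rewrite inE; apply/forallP=> i; have := zT i; rewrite inE esym => /forallP; exact.
  apply: leq_trans (subset_leq_card sub) _; apply: leq_trans (card_bigcup_le _ _) _.
  apply: leq_trans (_ : \sum_(z : {ffun 'I_s -> V}) K ^ t <= _).
    rewrite big_mkcond /=; apply: leq_sum => z _; rewrite inE; case: ifP => // ltK.
    by rewrite card_tuples_in; case: (t) => // t'; rewrite leq_exp2r // ltnW.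
  by rewrite sum_nat_const card_ffun card_ord.
(* Double counting of pairs (T, x) with [x] adjacent to every entry of [T]. *)
have sumU : \sum_(T : {ffun 'I_t -> V}) #|common_nbrs e T| = \sum_x #|[set y | e x y]| ^ t.
  transitivity (\sum_(T : {ffun 'I_t -> V}) \sum_x (x \in common_nbrs e T : nat)).
    by apply: eq_bigr => T _; rewrite sum_nat_bool_card.
  rewrite exchange_big /=; apply: eq_bigr => x _.
  rewrite sum_nat_bool_card -card_tuples_in; apply: eq_card => T.
  by rewrite unfold_in !inE; apply: eq_forallb => i; rewrite inE esym.
have lowU : n ^ t * n <= 2 * q ^ t * \sum_(T : {ffun 'I_t -> V}) #|common_nbrs e T|.
  rewrite sumU (bigID (mem X)) /= -mulnA.
  apply: leq_trans (leq_mul (leqnn _) leX) _.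
  rewrite mulnCA leq_mul2l /= mulnDr.
  apply: leq_trans (leq_addr _ _).
  rewrite big_distrr /= mulnC -sum_nat_const; apply: leq_sum => x.
  by rewrite inE -expnMn => le; case: (t) => // t'; rewrite leq_exp2r.
have [T /andP[nbT leT]] : exists T, ~~ bad T && (M <= #|common_nbrs e T|).
  apply/existsP; apply: contraLR ltn => /existsPn no.
  rewrite -leqNgt; apply: leq_trans lowU _; rewrite leq_mul2l; apply/orP; right.
  apply: leq_trans (_ : \sum_(T : {ffun 'I_t -> V}) ((T \in [set T | bad T]) * n + M) <= _).
    apply: leq_sum => T _; rewrite inE.
    have := no T; case: (bad T) => /=; first by rewrite mul1n => _; apply: leq_trans (max_card _) (leq_addr _ _).
    by rewrite -ltnNge => /ltnW.
  rewrite big_split /= -big_distrl /= sum_nat_bool_card sum_nat_const card_ffun card_ord leq_add2r.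
  by rewrite leq_mul2r (eq_card (B := [set T | bad T])) ?cbad ?orbT // => T.
exists (common_nbrs e T); split=> // z zT.
rewrite leqNgt; apply: contra nbT => ltK; apply/existsP; exists z.
by rewrite ltK andbT; apply/forallP.
Qed.

(** * Counting independent tuples *)

Definition nonadj_tuples (V : finType) (e : rel V) (U : {set V}) (s : nat) :=
  [set z : {ffun 'I_s -> V} | [forall i, z i \in U] &&
     [forall i, forall j, (i != j) ==> nonadj e (z i) (z j)]].

Definition extensions (V : finType) (e : rel V) (U : {set V}) (s : nat)
    (y : {ffun 'I_s -> V}) :=
  [set x in U | [forall j, nonadj e (y j) x]].

Definition insert_at (V : finType) (s : nat) (k : 'I_s.+1) (x : V) (y : {ffun 'I_s -> V}) :
    {ffun 'I_s.+1 -> V} :=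
  [ffun i => oapp y x (unlift k i)].

Definition delete_at (V : finType) (s : nat) (k : 'I_s.+1) (z : {ffun 'I_s.+1 -> V}) :
    {ffun 'I_s -> V} :=
  [ffun j => z (lift k j)].

Lemma insert_atE (V : finType) (s : nat) (k : 'I_s.+1) (x : V) (y : {ffun 'I_s -> V}) :
  insert_at k x y k = x.
Proof. by rewrite ffunE unlift_none. Qed.

Lemma insert_at_lift (V : finType) (s : nat) (k : 'I_s.+1) (x : V) (y : {ffun 'I_s -> V}) j :
  insert_at k x y (lift k j) = y j.
Proof. by rewrite ffunE liftK. Qed.

Lemma insert_atK (V : finType) (s : nat) (k : 'I_s.+1) (x : V) (y : {ffun 'I_s -> V}) :
  delete_at k (insert_at k x y) = y.
Proof. by apply/ffunP=> j; rewrite ffunE insert_at_lift. Qed.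

Lemma delete_atK (V : finType) (s : nat) (k : 'I_s.+1) (z : {ffun 'I_s.+1 -> V}) :
  insert_at k (z k) (delete_at k z) = z.
Proof.
by apply/ffunP=> i; case: (unliftP k i) => [j|] ->; rewrite ?insert_atE ?insert_at_lift ?ffunE.
Qed.

Lemma insert_nonadj_tuples (V : finType) (e : rel V) (U : {set V}) (s : nat)
    (k : 'I_s.+1) (x : V) (y : {ffun 'I_s -> V}) :
  simple_graph e ->
  (insert_at k x y \in nonadj_tuples e U s.+1) =
  (y \in nonadj_tuples e U s) && (x \in extensions e U y).
Proof.
move=> /nonadj_sym nsym; rewrite !inE; apply/idP/idP.
  case/andP=> /forallP inU /forallP ind; apply/andP; split; [apply/andP; split|apply/andP; split].
  - by apply/forallP=> j; have := inU (lift k j); rewrite insert_at_lift.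
  - apply/forallP=> i; apply/forallP=> j; apply/implyP=> ij.
    have /forallP/(_ (lift k j))/implyP := ind (lift k i).
    by rewrite !insert_at_lift; apply; rewrite (inj_eq lift_inj).
  - by have := inU k; rewrite insert_atE.
  - apply/forallP=> j; have /forallP/(_ k)/implyP := ind (lift k j).
    by rewrite insert_atE insert_at_lift; apply; rewrite eq_sym neq_lift.
case/andP=> /andP[/forallP yU /forallP ind] /andP[xU /forallP nx].
apply/andP; split; apply/forallP=> i; case: (unliftP k i) => [i'|] ->.
- by rewrite insert_at_lift.
- by rewrite insert_atE.
- apply/forallP=> j; apply/implyP; case: (unliftP k j) => [j'|] ->.
    rewrite (inj_eq lift_inj) !insert_at_lift => ij.
    by have /forallP/(_ j')/implyP := ind i'; apply.
  by rewrite insert_atE insert_at_lift.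
- apply/forallP=> j; apply/implyP; case: (unliftP k j) => [j'|] ->.
    by rewrite insert_atE insert_at_lift nsym.
  by rewrite eqxx.
Qed.

(** Insertion at position [k] is a bijection with inverse [z] to ([delete_at k z], [z k]). An
    arbitrary [k] is allowed because bad tuples are later counted along each coordinate in turn. *)
Lemma sum_nonadj_tuples (V : finType) (e : rel V) (U : {set V}) (s : nat)
    (k : 'I_s.+1) (F : {ffun 'I_s -> V} -> V -> nat) :
  simple_graph e ->
  \sum_(z in nonadj_tuples e U s.+1) F (delete_at k z) (z k) =
  \sum_(y in nonadj_tuples e U s) \sum_(x in extensions e U y) F y x.
Proof.
move=> sg; rewrite pair_big_dep /=.
rewrite (reindex (fun p : {ffun 'I_s -> V} * V => insert_at k p.2 p.1)) /=.
  apply: eq_big => [[y x]|[y x] _] /=; first exact: insert_nonadj_tuples.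
  by rewrite insert_atK insert_atE.
exists (fun z => (delete_at k z, z k)) => [[y x] _|z _] /=.
  by rewrite insert_atK insert_atE.
by rewrite delete_atK.
Qed.

(** Cauchy-Schwarz, by summing 2 d_i d_j <= d_i^2 + d_j^2 over all pairs. *)
Lemma sqr_sum_le (I : finType) (A : {set I}) (d : I -> nat) :
  (\sum_(i in A) d i) ^ 2 <= #|A| * \sum_(i in A) d i ^ 2.
Proof.
have -> : (\sum_(i in A) d i) ^ 2 = \sum_(i in A) \sum_(j in A) d i * d j.
  by rewrite -mulnn big_distrl /=; apply: eq_bigr => i _; rewrite big_distrr.
have eq2 : \sum_(i in A) \sum_(j in A) (d i ^ 2 + d j ^ 2) = 2 * (#|A| * \sum_(i in A) d i ^ 2).
  under eq_bigr => i _ do rewrite big_split /= sum_nat_const.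
  by rewrite big_split /= sum_nat_const -big_distrr /= mul2n addnn.
rewrite -(leq_pmul2l (isT : 0 < 2)) -eq2 big_distrr /=; apply: leq_sum => i _.
by rewrite big_distrr /=; apply: leq_sum => j _; exact: (nat_Cauchy (d i) (d j)).1.
Qed.

Lemma card_nonadj_tuplesS (V : finType) (e : rel V) (U : {set V}) (s : nat) :
  simple_graph e ->
  #|nonadj_tuples e U s.+1| = \sum_(y in nonadj_tuples e U s) #|extensions e U y|.
Proof.
move=> sg; rewrite -sum1_card (sum_nonadj_tuples U ord0 (fun _ _ => 1)) //.
by apply: eq_bigr => y _; rewrite sum1_card.
Qed.

(** All but fewer than [m] vertices of [D] have at least |D|/(4m) non-neighbours in [D]; when |D| <
    4m the last term alone suffices. *)
Lemma nonadj_pairs_ge (V : finType) (e : rel V) (m : nat) (D : {set V}) :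
  simple_graph e -> ~ has_Kmm e m ->
  #|D| ^ 2 <= 8 * m * (\sum_(x in D) #|[set w in D | nonadj e x w]|) + 4 * m * #|D|.
Proof.
move=> sg nK; case: (leqP (4 * m) #|D|) => [leD|/ltnW ltD]; last first.
  by apply: leq_trans (leq_addl _ _); rewrite -mulnn leq_mul2r ltD orbT.
have /ltnW := few_nearly_complete sg nK leD; set B := [set x | _] => cB.
have : #|D :\: B| * #|D| <= 4 * m * (\sum_(x in D) #|[set w in D | nonadj e x w]|).
  rewrite (bigID (mem B)) /= mulnDr; apply: leq_trans (leq_addl _ _).
  rewrite -sum_nat_const big_distrr /= [in leqRHS](eq_bigl (mem (D :\: B))); last first.
    by move=> x; rewrite !inE andbC.
  by apply: leq_sum => x; rewrite !inE -leqNgt => /andP[].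
have := cardsD D B; have := subset_leq_card (subsetIr D B).
set S := \sum_(_ in _) _; nia.
Qed.

(** A tuple of length s+2 is an [s]-tuple [y] with an ordered non-adjacent pair of extensions of
    [y]. Apply Cauchy-Schwarz to the numbers of extensions, then [nonadj_pairs_ge] inside each
    extension set. *)
Lemma nonadj_tuples_log_convex (V : finType) (e : rel V) (m : nat) (U : {set V}) (s : nat) :
  simple_graph e -> ~ has_Kmm e m ->
  #|nonadj_tuples e U s.+1| ^ 2 <=
  #|nonadj_tuples e U s| * (8 * m * #|nonadj_tuples e U s.+2| + 4 * m * #|nonadj_tuples e U s.+1|).
Proof.
move=> sg nK.
have card1 t := card_nonadj_tuplesS U t sg.
have card2 : #|nonadj_tuples e U s.+2| = \sum_(y in nonadj_tuples e U s)
    \sum_(x in extensions e U y) #|[set w in extensions e U y | nonadj e x w]|.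
  rewrite card1 -(sum_nonadj_tuples U ord0 (fun y x => #|[set w in extensions e U y | nonadj e x w]|)) //.
  apply: eq_bigr => z _; apply: eq_card => w; rewrite !inE -andbA; congr (_ && _).
  apply/forallP/andP => [nz|[/forallP ny nx] j].
    by split=> //; apply/forallP=> j; rewrite ffunE.
  by case: (unliftP ord0 j) => [i|] -> //; have := ny i; rewrite ffunE.
rewrite {1}card1; apply: leq_trans (sqr_sum_le _ _) _; rewrite leq_mul2l; apply/orP; right.
rewrite card2 card1 !big_distrr /= -big_split /=; apply: leq_sum => y _.
exact: nonadj_pairs_ge.
Qed.

(** The ratio of consecutive counts starts at |U| >= M, and log-convexity lets it drop by a factor
    of at most 16m per step. *)
Lemma nonadj_tuples_growth (V : finType) (e : rel V) (m M : nat) (U : {set V}) (s : nat) :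
  simple_graph e -> ~ has_Kmm e m -> 0 < m -> M <= #|U| -> 8 * m * (16 * m) ^ s <= M ->
  0 < #|nonadj_tuples e U s| /\
  M * #|nonadj_tuples e U s| <= (16 * m) ^ s * #|nonadj_tuples e U s.+1|.
Proof.
move=> sg nK m0 MU.
have card0 : #|nonadj_tuples e U 0| = 1.
  have -> : nonadj_tuples e U 0 = setT.
    apply/setP=> z; rewrite !inE; apply/andP; split; apply/forallP; by case.
  by rewrite cardsT card_ffun card_ord.
elim: s => [|s IHs] leM.
  split; first by rewrite card0.
  rewrite card0 mul1n muln1; apply: leq_trans MU _.
  rewrite card_nonadj_tuplesS //.
  rewrite (eq_bigr (fun _ => #|U|)) ?sum_nat_const ?card0 ?mul1n // => y _.
  apply: eq_card => x; rewrite inE andbC.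
  by case: forallP => // -[]; case.
have leM' : 8 * m * (16 * m) ^ s <= M.
  by apply: leq_trans leM; rewrite leq_mul2l leq_exp2l ?leqnSn ?orbT //; lia.
have [pos IH] := IHs leM'.
have conv := nonadj_tuples_log_convex U s sg nK.
move: pos IH conv; set a := #|_|; set b := #|nonadj_tuples e U s.+1|.
set c := #|nonadj_tuples e U s.+2| => pos IH conv.
have pP : 0 < (16 * m) ^ s by rewrite expn_gt0; lia.
(* This makes the error term 4m a b at most b^2/2, so it is absorbed at the price of doubling 8m to
   16m. *)
have le8 : 8 * m * a <= b.
  rewrite -(leq_pmul2l pP); apply: leq_trans IH.
  by rewrite mulnA leq_mul2r (mulnC _ (8 * m)) leM' orbT.
split; first nia.
have b2 : b ^ 2 <= 16 * m * (a * c) by move: conv le8; nia.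
rewrite -(leq_pmul2l pos) expnS.
have : (16 * m) ^ s * b ^ 2 <= (16 * m) ^ s * (16 * m * (a * c)) by rewrite leq_mul2l b2 orbT.
have : b * (M * a) <= b * ((16 * m) ^ s * b) by rewrite leq_mul2l IH orbT.
set p := (16 * m) ^ s; rewrite -mulnn => h1 h2.
lia.
Qed.

(** * Transversals and adjacency patterns *)

(** Greedy choice: pick [x] in the first set outside the nearly complete vertices of the others,
    then restrict those to non-neighbours of [x], losing a factor 4m. The constant [c] stays fixed
    while [k] drops, so each set remains larger than the number of excluded vertices. *)
Lemma nonadj_transversal (V : finType) (e : rel V) (m c k : nat) (W : 'I_k -> {set V}) :
  simple_graph e -> ~ has_Kmm e m -> 0 < m -> k <= c ->
  (forall i, c * (4 * m) ^ k <= #|W i|) ->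
  exists w : 'I_k -> V, (forall i, w i \in W i) /\
    forall i j, i != j -> nonadj e (w i) (w j).
Proof.
move=> sg nK m0; elim: k W => [|k IHk] W kc leW.
  have f0 : 'I_0 -> V by case.
  by exists f0; split; case.
pose nearly_complete i := [set x | 4 * m * #|[set w in W i | nonadj e x w]| < #|W i|].
have qpos j : 0 < (4 * m) ^ j by rewrite expn_gt0; lia.
have leW4 i : 4 * m <= #|W i|.
  by apply: leq_trans (leW i); rewrite expnS mulnCA leq_pmulr // muln_gt0 qpos andbT; lia.
have cbad : #|\bigcup_(i in [set: 'I_k]) nearly_complete (lift ord0 i)| <= k * m.
  apply: leq_trans (card_bigcup_le _ _) _.
  rewrite -[in leqRHS](card_ord k) -cardsT -sum_nat_const; apply: leq_sum => i _.
  exact/ltnW/few_nearly_complete.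
have [x xW xgood] : exists2 x, x \in W ord0 & x \notin \bigcup_(i in [set: 'I_k]) nearly_complete (lift ord0 i).
  apply/subsetPn; apply/negP=> /subset_leq_card; apply/negP; rewrite -ltnNge.
  apply: leq_ltn_trans cbad _; apply: leq_trans (leW ord0); rewrite expnS mulnCA.
  apply: leq_trans (leq_mul (leqnn _) (leq_pmulr c (qpos k))); nia.
have [|i|w [wW wn]] := IHk (fun i => [set w in W (lift ord0 i) | nonadj e x w]); first exact: ltnW.
  rewrite -(leq_pmul2l (_ : 0 < 4 * m)); last lia.
  apply: leq_trans (_ : #|W (lift ord0 i)| <= _).
    by apply: leq_trans (leW _); rewrite expnS mulnCA.
  rewrite leqNgt; apply: contra xgood => bad.
  by apply/bigcupP; exists i; rewrite ?inE.
exists (fun i => oapp w x (unlift ord0 i)); split=> [i|i j].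
  by case: unliftP => [i'|] -> //=; have := wW i'; rewrite inE => /andP[].
case: unliftP => [i'|] ->; case: unliftP => [j'|] -> //=.
- by rewrite (inj_eq lift_inj); apply: wn.
- by have := wW i'; rewrite inE (nonadj_sym sg) => /andP[].
- by have := wW j'; rewrite inE => /andP[].
Qed.

(** Two predicates, because an index may also be left unconstrained; this allows non-adjacencies to
    be imposed one index at a time. *)
Definition pattern_nbrs (V : finType) (e : rel V) (s : nat) (P Q : pred 'I_s)
    (z : {ffun 'I_s -> V}) :=
  [set w | [forall i, (P i ==> e (z i) w) && (Q i ==> nonadj e (z i) w)]].

(** Exhibits the set as a function of the other coordinates, the form required by
    [card_bad_tuples]. *)
Lemma pattern_nbrs_delete (V : finType) (e : rel V) (s : nat) (P Q : pred 'I_s.+1)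
    (k : 'I_s.+1) (z : {ffun 'I_s.+1 -> V}) :
  ~~ P k -> ~~ Q k ->
  pattern_nbrs e P Q z =
  pattern_nbrs e (fun j => P (lift k j)) (fun j => Q (lift k j)) (delete_at k z).
Proof.
move=> /negbTE nP /negbTE nQ; apply/setP=> w; rewrite !inE.
apply/forallP/forallP=> H i; first by rewrite !ffunE.
case: (unliftP k i) => [j|] ->; first by have := H j; rewrite ffunE.
by rewrite nP nQ.
Qed.

(** Since [W] ignores coordinate [k], fixing the other coordinates fixes the set, and
    [few_nearly_complete] leaves fewer than [m] values for [z k]. *)
Lemma card_bad_tuples (V : finType) (e : rel V) (m : nat) (U : {set V}) (s : nat)
    (k : 'I_s.+1) (W : {ffun 'I_s -> V} -> {set V}) :
  simple_graph e -> ~ has_Kmm e m ->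
  #|[set z in nonadj_tuples e U s.+1 | (4 * m <= #|W (delete_at k z)|) &&
      (4 * m * #|[set w in W (delete_at k z) | nonadj e (z k) w]| < #|W (delete_at k z)|)]|
  <= #|nonadj_tuples e U s| * m.
Proof.
move=> sg nK.
pose F y x : nat := (4 * m <= #|W y|) && (4 * m * #|[set w in W y | nonadj e x w]| < #|W y|).
have -> : #|[set z in nonadj_tuples e U s.+1 | (4 * m <= #|W (delete_at k z)|) &&
      (4 * m * #|[set w in W (delete_at k z) | nonadj e (z k) w]| < #|W (delete_at k z)|)]|
   = \sum_(z in nonadj_tuples e U s.+1) F (delete_at k z) (z k).
  rewrite -sum1_card big_mkcond [RHS]big_mkcond; apply: eq_bigr => z _.
  by rewrite inE /F; case: (z \in _) => //=; case: (_ && _).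
rewrite (sum_nonadj_tuples U k F sg) -sum_nat_const; apply: leq_sum => y _.
rewrite /F; case: (leqP (4 * m) #|W y|) => [le|_]; last by rewrite big1.
apply: leq_trans (ltnW (few_nearly_complete sg nK le)); set B := [set x | _].
rewrite -[#|B|]sum1_card big_mkcond [leqRHS]big_mkcond /=; apply: leq_sum => x _.
by rewrite [x \in B]inE; case: (x \in _) => //; case: (_ < _).
Qed.

(** Union bound over pairs (b, k): at most (s+1)^2 m N_s tuples are bad, fewer than N_(s+1) by the
    growth estimate. For a tuple that is never bad, each imposed non-adjacency costs a factor of at
    most 4m. *)
Lemma shattered_tuple (V : finType) (e : rel V) (m M K : nat) (U : {set V}) (s : nat)
    (r : rel 'I_s.+1) :
  simple_graph e -> ~ has_Kmm e m -> 0 < m -> M <= #|U| ->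
  8 * m * (16 * m) ^ s <= M -> s.+1 * s.+1 * m * (16 * m) ^ s < M ->
  (4 * m) ^ s.+2 <= K ->
  (forall z : {ffun 'I_s.+1 -> V}, (forall i, z i \in U) -> K <= #|common_nbrs e z|) ->
  exists2 z, z \in nonadj_tuples e U s.+1 &
    forall b, K <= (4 * m) ^ s.+1 * #|pattern_nbrs e (r^~ b) (fun i => ~~ r i b) z|.
Proof.
move=> sg nK m0 MU leM ltM leK cnU.
have [pos growth] := nonadj_tuples_growth sg nK m0 MU leM.
pose Q b (k : nat) : pred 'I_s.+1 := fun i => ~~ r i b && (i < k).
pose W b k := pattern_nbrs e (fun j => r (lift k j) b) (fun j => Q b k (lift k j)).
pose bad (p : 'I_s.+1 * 'I_s.+1) := [set z in nonadj_tuples e U s.+1 |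
  (4 * m <= #|W p.1 p.2 (delete_at p.2 z)|) &&
  (4 * m * #|[set w in W p.1 p.2 (delete_at p.2 z) | nonadj e (z p.2) w]|
     < #|W p.1 p.2 (delete_at p.2 z)|)].
have cbad : #|\bigcup_(p in [set: 'I_s.+1 * 'I_s.+1]) bad p| <= s.+1 * s.+1 * (#|nonadj_tuples e U s| * m).
  apply: leq_trans (card_bigcup_le _ _) _.
  rewrite -[in leqRHS](card_ord s.+1) -card_prod -cardsT -sum_nat_const; apply: leq_sum => p _.
  exact: card_bad_tuples.
have [z zU zgood] : exists2 z, z \in nonadj_tuples e U s.+1 &
    z \notin \bigcup_(p in [set: 'I_s.+1 * 'I_s.+1]) bad p.
  apply/subsetPn; apply/negP=> /subset_leq_card; apply/negP; rewrite -ltnNge.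
  apply: leq_ltn_trans cbad _.
  have p0 : 0 < (16 * m) ^ s by rewrite expn_gt0; lia.
  rewrite -(ltn_pmul2l p0); apply: leq_trans growth.
  rewrite -(ltn_pmul2r pos) in ltM; apply: leq_trans ltM; rewrite ltnS; lia.
exists z => // b.
have q0 j : 0 < (4 * m) ^ j by rewrite expn_gt0; lia.
(* Non-neighbours are imposed for the indices below k only, so that the set at stage k does not
   depend on z k when r k b fails. *)
have main k : k <= s.+1 -> K <= (4 * m) ^ k * #|pattern_nbrs e (r^~ b) (Q b k) z|.
  elim: k => [_|k IH ltk].
    (* At stage 0 only adjacencies are required, so the whole common neighbourhood of [z]
       qualifies. *)
    rewrite mul1n; apply: leq_trans (cnU z _) _.
      by move: zU; rewrite inE => /andP[/forallP].
    apply/subset_leq_card/subsetP=> w; rewrite !inE => /forallP ew.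
    by apply/forallP=> i; rewrite ew implybT /Q ltn0 andbF.
  have {}IH := IH (ltnW ltk).
  pose k' := Ordinal ltk.
  have eqQ i : Q b k.+1 i = Q b k i || (~~ r i b && (i == k')).
    by rewrite /Q ltnS leq_eqVlt -val_eqE /= -andb_orr orbC.
  case rk : (r k' b).
    apply: leq_trans IH _; apply: leq_mul; first by rewrite leq_exp2l; lia.
    apply/subset_leq_card/subsetP=> w; rewrite !inE => /forallP H; apply/forallP=> i.
    have := H i; rewrite eqQ; case: eqP => [->|_]; first by rewrite rk /= orbF.
    by rewrite andbF orbF.
  have WE : pattern_nbrs e (r^~ b) (Q b k) z = W b k' (delete_at k' z).
    by rewrite (@pattern_nbrs_delete V e s _ _ k') ?rk // /Q ltnn andbF.
  have stepE : pattern_nbrs e (r^~ b) (Q b k.+1) z =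
      [set w in pattern_nbrs e (r^~ b) (Q b k) z | nonadj e (z k') w].
    apply/setP=> w; rewrite !inE; apply/forallP/andP=> [H|[/forallP H nk] i].
      split; last by have /andP[_] := H k'; rewrite eqQ rk eqxx orbT.
      by apply/forallP=> i; have := H i; rewrite eqQ; case: (Q b k i) => //=; rewrite andbT => /andP[->].
    have := H i; rewrite eqQ; case: eqP => [->|_]; last by rewrite andbF orbF.
    by rewrite nk !implybT andbT.
  (* Here k <= s, so K >= (4m)^(s+2) still leaves 4m vertices after [k] losses. *)
  have leW : 4 * m <= #|pattern_nbrs e (r^~ b) (Q b k) z|.
    rewrite -(leq_pmul2l (q0 k)); apply: leq_trans IH; apply: leq_trans leK.
    by rewrite -expnSr leq_exp2l; lia.
  apply: leq_trans IH _; rewrite expnSr -mulnA leq_mul2l stepE leqNgt.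
  apply/orP; right; apply: contra zgood => lt; apply/bigcupP; exists (b, k') => //.
  by rewrite inE zU /= -WE leW.
apply: leq_trans (main s.+1 (leqnn _)) _; rewrite leq_mul2l; apply/orP; right.
apply/subset_leq_card/subsetP=> w; rewrite !inE => /forallP H; apply/forallP=> i.
by have := H i; rewrite /Q ltn_ord andbT.
Qed.

(** * Choice of parameters and the induced copy *)

Lemma bipartite_embedding (V : finType) (e : rel V) (m h : nat) (r : rel 'I_h) :
  simple_graph e -> ~ has_Kmm e m ->
  (forall S : {set V}, independent e S -> #|S| < m) ->
  16 <= m -> 0 < h <= m -> m ^ (19 * h) <= #|V| ->
  exists a w : 'I_h -> V,
    [/\ forall i j, i != j -> nonadj e (a i) (a j),
        forall i j, i != j -> nonadj e (w i) (w j) &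
        forall i j, if r i j then e (a i) (w j) else nonadj e (a i) (w j)].
Proof.
move=> sg nK ind m16; case: h r => // s r /= hm leV.
have m0 : 0 < m by lia.
have m1 : 1 < m by lia.
(* As 16 <= m, both 4m and 16m are at most m^2, and every numerical condition becomes a comparison
   of exponents of [m]. *)
have exp2 c k : c * m <= m ^ 2 -> (c * m) ^ k <= m ^ (2 * k).
  by move=> le; rewrite expnM; case: k => // k; rewrite leq_exp2r.
have e4 k : (4 * m) ^ k <= m ^ (2 * k) by apply: exp2; rewrite -mulnn leq_mul2r; lia.
have e16 k : (16 * m) ^ k <= m ^ (2 * k) by apply: exp2; rewrite -mulnn leq_mul2r; lia.
have mono i j : i <= j -> m ^ i <= m ^ j by move=> le; rewrite leq_exp2l.
have V1 : m ^ 19 <= #|V| by apply: leq_trans leV; apply: mono; lia.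
have Vpos : 0 < #|V| by apply: leq_trans V1; rewrite expn_gt0 m0.
have V4 : 4 * m < #|V|.
  apply: leq_trans V1; apply: leq_trans (mono 3 19 isT).
  by rewrite !expnS; nia.
have deg := high_degree sg m0 ind V4.
set n := #|V| in leV V1 Vpos V4 deg *.
(* With h = s+1, the transversal needs h (4m)^(2h) <= m^(4h+1) <= K. The choice of [M] is looser: it
   must exceed m^(2h+1) for [shattered_tuple] and satisfy 4 (4m)^t M < n. *)
pose t := 2 * s.+1; pose K := m ^ (5 * s.+1); pose M := m ^ (6 * s.+1).
have [|U [MU cnU]] := @dependent_random_choice V e (4 * m) s.+1 t K M sg deg.
  rewrite -/n.
  (* With t = 2h this reduces to 4 (4 m K)^2 < n. *)
  have b1 : 4 * ((4 * m) ^ t * K ^ t) < n ^ s.+1.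
    rewrite -expnMn /t expnM.
    have le : (4 * m * K) ^ 2 <= m ^ (14 * s.+1).
      apply: leq_trans (_ : (m ^ (7 * s.+1)) ^ 2 <= _); last first.
        by rewrite -expnM; apply: mono; lia.
      rewrite leq_exp2r //; apply: leq_trans (leq_mul (_ : 4 * m <= m ^ 2) (leqnn K)) _.
        by rewrite -mulnn leq_mul2r; lia.
      by rewrite /K -expnD; apply: mono; lia.
    apply: leq_trans (_ : (m ^ (19 * s.+1)) ^ s.+1 <= _); last by rewrite leq_exp2r.
    apply: leq_ltn_trans (_ : m ^ 1 * (m ^ (14 * s.+1)) ^ s.+1 < _).
      by apply: leq_mul; [lia | rewrite leq_exp2r].
    by rewrite -!expnM -expnD ltn_exp2l //; nia.
  have b2 : 4 * ((4 * m) ^ t * M) < n.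
    apply: leq_trans leV; apply: leq_ltn_trans (_ : m ^ 1 * (m ^ (2 * t) * M) < _).
      by apply: leq_mul; [lia | apply: leq_mul].
    by rewrite /M -!expnD ltn_exp2l // /t; lia.
  have nt : n ^ t = n ^ s.+1 * n ^ s.+1 by rewrite /t -expnD addnn mul2n.
  have npos : 0 < n ^ s.+1 by rewrite expn_gt0 Vpos.
  rewrite nt; move: b1 b2 npos.
  set X := n ^ s.+1; set A := (4 * m) ^ t; set B := K ^ t => b1 b2 npos.
  (* Each of the two terms is less than half of n^t n. *)
  have c1 : 4 * (A * B) * (X * n) < X * (X * n) by rewrite ltn_pmul2r // muln_gt0 npos.
  have c2 : X * X * (4 * (A * M)) < X * X * n by rewrite ltn_pmul2l // muln_gt0 npos.
  lia.
have [|||z zU zW] := @shattered_tuple V e m M K U s r sg nK m0 MU _ _ _ cnU.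
- apply: leq_trans (leq_mul (_ : 8 * m <= m ^ 2) (e16 s)) _.
    by rewrite -mulnn leq_mul2r; lia.
  by rewrite -expnD; apply: mono; lia.
- apply: leq_ltn_trans (leq_mul (leq_mul (leq_mul (_ : _ <= m ^ 1) (_ : _ <= m ^ 1)) (_ : _ <= m ^ 1)) (e16 s)) _ => //.
  by rewrite -!expnD ltn_exp2l //; lia.
- by apply: leq_trans (e4 _) _; apply: mono; lia.
have [|w [wW wn]] := @nonadj_transversal V e m s.+1 s.+1
    (fun b => pattern_nbrs e (r^~ b) (fun i => ~~ r i b) z) sg nK m0 (leqnn _).
  move=> b; have qp : 0 < (4 * m) ^ s.+1 by rewrite expn_gt0; lia.
  rewrite -(leq_pmul2l qp); apply: leq_trans (zW b).
  apply: leq_trans (leq_mul (e4 _) (leq_mul (_ : _ <= m ^ 1) (e4 _))) _ => //.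
  by rewrite -!expnD; apply: mono; lia.
exists z, w; split=> //.
  move=> i j ij; move: zU; rewrite inE => /andP[_ /forallP/(_ i)/forallP/(_ j)].
  by rewrite ij.
move=> i j; have := wW j; rewrite inE => /forallP/(_ i).
by case: (r i j) => //= /andP[].
Qed.

(** The embedding is applied with [eH] itself as the pattern. Injectivity holds because both
    adjacency and [nonadj] force distinct vertices. *)
Lemma bipartite_induced_copy (V : finType) (e : rel V) (m h : nat) (eH : rel 'I_h) :
  simple_graph e -> simple_graph eH -> bipartite eH ->
  ~ has_Kmm e m -> (forall S : {set V}, independent e S -> #|S| < m) ->
  16 <= m -> 0 < h <= m -> m ^ (19 * h) <= #|V| ->
  has_induced_copy eH e.
Proof.
move=> sg [symH irrH] [col colP] nK ind m16 hm leV.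
have [a [w [na nw naw]]] := bipartite_embedding eH sg nK ind m16 hm leV.
have [esym eirr] := sg.
pose f x := if col x then a x else w x.
have noH x y : col x = col y -> eH x y = false.
  by move=> eqc; apply/negP=> /colP.
have cross x y : (a x != w y) && (e (a x) (w y) == eH x y).
  have := naw x y; case: (eH x y); last by case/andP=> -> /negbTE ->.
  by move=> exy; rewrite exy eqxx andbT; apply: contraTneq exy => ->; rewrite eirr.
exists f; split=> x y; rewrite /f.
  case: (eqVneq x y) => // xy.
  case: ifP => _; case: ifP => _ eqf.
  - by have := na x y xy; rewrite eqf /nonadj eqxx.
  - by have := cross x y; rewrite eqf eqxx.
  - by have := cross y x; rewrite eqf eqxx.
  - by have := nw x y xy; rewrite eqf /nonadj eqxx.
case: (eqVneq x y) => [->|xy]; first by rewrite eirr irrH.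
case cx: (col x); case cy: (col y).
- by rewrite noH ?cx ?cy //; have /andP[_ /negbTE] := na x y xy.
- by have /andP[_ /eqP] := cross x y.
- by rewrite esym symH; have /andP[_ /eqP] := cross y x.
- by rewrite noH ?cx ?cy //; have /andP[_ /negbTE] := nw x y xy.
Qed.

(** * Integer roots and real exponents *)

(** Take the least [m] with n <= m^D. Then m^D <= 2^D (m-1)^D <= m n, because 2^D <= m, and a factor
    [m] cancels. *)
Lemma nat_root (n D : nat) : 0 < D -> (2 ^ D) ^ D < n ->
  exists m, [/\ 2 ^ D <= m, n <= m ^ D & m ^ D.-1 <= n].
Proof.
move=> D0 ltn.
have ex : exists m, n <= m ^ D by exists n; case: D D0 {ltn} => // D _; rewrite expnS; case: n => // n; rewrite leq_pmulr // expn_gt0.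
exists (ex_minn ex); case: ex_minnP => m le min.
have ltm : 2 ^ D < m by rewrite -(ltn_exp2r _ _ D0); apply: leq_trans le.
have lt1 : m.-1 ^ D < n.
  by rewrite ltnNge; apply/negP=> /min; have := leq_trans (leq0n _) ltm; lia.
split=> //; first exact: ltnW.
have m0 : 0 < m by apply: leq_ltn_trans ltm.
have D2 : 2 <= 2 ^ D by rewrite -[X in X <= _]expn1 leq_exp2l.
rewrite -(leq_pmul2l m0) -expnS prednK //.
apply: leq_trans (_ : (2 * m.-1) ^ D <= _); first by rewrite leq_exp2r //; lia.
by rewrite expnMn; apply: leq_mul; apply: ltnW.
Qed.

(* From here on [^] on [nat] parses as [Nat.pow], hence the explicit [expn]. *)
From Stdlib Require Import Reals Lra Classical.

Lemma INR_expn (m k : nat) : INR (expn m k) = (INR m ^ k)%R.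
Proof. by elim: k => [|k IH]; rewrite ?expn0 // expnS mult_INR IH. Qed.

Lemma root_le_nat (n m h : nat) : 0 < n -> 0 < h -> n <= expn m (20 * h) ->
  (Rpower (INR n) (1 / 20 / INR h) <= INR m)%R.
Proof.
move=> n0 h0 le.
have m0 : 0 < m by case: m le => //; rewrite exp0n; lia.
have hR : (0 < INR h)%R by apply: lt_0_INR; lia.
have mR : (0 < INR m)%R by apply: lt_0_INR; lia.
have nR : (0 < INR n)%R by apply: lt_0_INR; lia.
have -> : INR m = Rpower (INR m ^ (20 * h)) (1 / 20 / INR h).
  rewrite -Rpower_pow // Rpower_mult mult_INR.
  have -> : (INR 20 * INR h * (1 / 20 / INR h) = 1)%R by simpl; field; lra.
  by rewrite Rpower_1.
apply: Rle_Rpower_l.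
  by apply: Rlt_le; apply: Rdiv_lt_0_compat => //; lra.
by split=> //; rewrite -INR_expn; apply: le_INR; lia.
Qed.

Theorem theorem1p8 :
  exists c : R, (0 < c)%R /\
  forall (h : nat) (eH : rel 'I_h),
    simple_graph eH -> bipartite eH ->
    exists n0 : nat, forall (n : nat), n0 <= n ->
    forall eG : rel 'I_n, simple_graph eG -> ~ has_induced_copy eH eG ->
      (exists S : {set 'I_n}, independent eG S /\
         (Rpower (INR n) (c / INR h) <= INR #|S|)%R) \/
      (exists m : nat, (Rpower (INR n) (c / INR h) <= INR m)%R /\ has_Kmm eG m).
Proof.
exists (1 / 20)%R; split; first lra.
case=> [|h] eH sgH bipH.
  (* For h = 0 the empty graph is an induced subgraph of every graph, contradicting the assumption
     on [eG]. *)
  exists 0 => n _ eG _ []; have f0 : 'I_0 -> 'I_n by case.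
  by exists f0; split; case.
pose D := 20 * h.+1.
(* This threshold forces m >= 2^D, hence both m >= 16 and m >= h. *)
exists (expn (expn 2 D) D).+1 => n ltn eG sgG nocopy.
have [m [lem len gem]] := nat_root (isT : 0 < D) ltn.
have rootm : (Rpower (INR n) (1 / 20 / INR h.+1) <= INR m)%R.
  by apply: root_le_nat => //; lia.
case: (classic (has_Kmm eG m)) => [Kmm|nK]; first by right; exists m.
left; apply: NNPP => noS; apply: nocopy.
have D16 : 16 <= m.
  by apply: leq_trans lem; rewrite (_ : 16 = expn 2 4) // leq_exp2l // /D; lia.
have hm : 0 < h.+1 <= m.
  by rewrite /=; apply: leq_trans lem; apply: leq_trans (ltnW (ltn_expl D (isT : 1 < 2))); rewrite /D; lia.
apply: (bipartite_induced_copy sgG sgH bipH nK _ D16 hm).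
  move=> S indS; rewrite ltnNge; apply/negP=> leS; apply: noS; exists S; split=> //.
  by apply: Rle_trans rootm _; apply/le_INR/leP.
(* Since 19h <= 20h - 1 for h >= 1, the bound m^(D-1) <= n gives the required m^(19h) <= n. *)
rewrite card_ord; apply: leq_trans gem; rewrite leq_exp2l; last lia.
by rewrite /D; lia.
Qed.
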